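(* Let $\mu_1$ be a probability measure on $[0,\infty)$ and let $\mu_2$ be a probability measure on $\mathbb{R}$. Then there exists a probability measure $\mu$ on $\mathbb{R}$ such that $\eta_\mu(z)=\eta_{\mu_1}(\eta_{\mu_2}(z))$ for all $z\in\mathbb{C}^-$. (This measure is denoted $\mu_1\circlearrowright\mu_2$ and called the multiplicative monotone convolution of $\mu_1$ and $\mu_2$.)
   Context: For a probability measure $\mu$ on $\mathbb{R}$, $G_\mu(z)=\int_{\mathbb{R}}\frac{\mu(dx)}{z-x}$, $F_\mu=1/G_\mu$, and $\eta_\mu(z)=1-zF_\mu(1/z)$ for $z$ in the open lower half-plane $\mathbb{C}^-$. If $\mu$ is supported on $[0,\infty)$, then $\eta_\mu$ is defined and analytic on $\mathbb{C}\setminus[0,\infty)$ by the same formula. If $\mu_2\neq\delta_0$, then $\eta_{\mu_2}(\mathbb{C}^-)\subset\mathbb{C}\setminus[0,\infty)$. If $\mu_2=\delta_0$, then $\eta_{\mu_2}\equiv0$ and one sets $\eta_{\mu_1}(0)=0$. *)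

(* Defs.v *)
From HB Require Import structures.
From mathcomp Require Import all_boot all_order all_algebra.
From mathcomp Require Import complex.
From mathcomp Require Import all_classical all_reals all_analysis.

Set Implicit Arguments.
Unset Strict Implicit.
Unset Printing Implicit Defensive.

Import Order.TTheory GRing.Theory Num.Theory.
Import numFieldNormedType.Exports.

Local Open Scope ring_scope.
Local Open Scope complex_scope.

(* The Lebesgue integral of a complex-valued function, taken componentwise;
   it is the intended value when both components are integrable. *)
Definition Cintegral d (T : measurableType d) (R : realType)
    (mu : {measure set T -> \bar R}) (f : T -> R[i]) : R[i] :=
  (\int[mu]_x complex.Re (f x)) +i* (\int[mu]_x complex.Im (f x)).

Definition Gtransform (R : realType)
    (mu : probability (measurableTypeR R) R) (z : R[i]) : R[i] :=
  Cintegral mu (fun x : measurableTypeR R => (z - (x : R)%:C)^-1).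

Definition Ftransform (R : realType)
    (mu : probability (measurableTypeR R) R) (z : R[i]) : R[i] :=
  (Gtransform mu z)^-1.

(* The formula is meant for [z] in the open lower half-plane, and for [z]
   outside [0, +oo[ when [mu] is supported on [0, +oo[. The value at 0 is the
   convention eta 0 = 0: the formula alone would give 1 there, because
   [0^-1 = 0]. *)
Definition eta_transform (R : realType)
    (mu : probability (measurableTypeR R) R) (z : R[i]) : R[i] :=
  if z == 0 then 0 else 1 - z * Ftransform mu z^-1.

(* Main.v *)
Require Import Defs.
From HB Require Import structures.
From mathcomp Require Import all_boot all_order all_algebra.
From mathcomp Require Import complex ring lra spectral sesquilinear.
From mathcomp Require Import all_classical all_reals all_analysis.
From mathcomp Require Import measurable_realfun.

(** Write [w = 1/z], so that [z] ranges over the lower half-plane exactly when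
    [w] ranges over the upper one, and let [G2], [F2] be the Cauchy transform of
    [mu2] and its reciprocal. From [1 - eta_mu2 z = z * F2 w] one computes that
    [mu] solves the problem as soon as its Cauchy transform is
      [ G_mu w = \int K_t w mu1(dt),   K_t w = 1 / ((1 - t) w + t F2 w), ]
    for all [w] in the upper half-plane ([eta_transform_identity]). Here [K_t]
    should be the Cauchy transform of [delta_t] convolved with [mu2], which is
    the [t]-th Boolean convolution power of [mu2]; the measure [mu] is then the
    mixture of these powers over [mu1]. It remains to show that [K_t] and the
    mixture are Cauchy transforms of probability measures.

    For a finitely supported [mu2] this is linear algebra
    ([boolean_power_finite]): [G2 w = <xi, (w - A)^-1 xi>] with [A] real
    diagonal and [xi] a unit vector, and [K_t] is obtained when [A] is replaced
    by the symmetric matrix [S A S], where [S] multiplies [xi] by [sqrt t] and is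
    the identity on its orthogonal. The spectral theorem turns this back into a
    finitely supported probability.

    The general case is a limit of this one. To take limits without discussing
    measures, we work with means: positive normalized linear functionals on
    bounded measurable functions, that is, finitely additive probabilities. A
    sequence of means always has a limit along an ultrafilter ([mean_limit]).
    Approximating [mu2] by its images under finitely valued functions gives a
    mean with Cauchy transform [K_t] ([boolean_power_mean]); approximating [mu1]
    in the same way gives a mean with the mixture as its Cauchy transform
    ([convolution_mean]). Everything is kept under control by the inequality
    [Im (F2 w) >= Im w], which implies [|K_t w| <= 1 / Im w] for all [t >= 0].

    Finally, a mean [L] whose Cauchy transform satisfies [i y G (i y) -> 1] is
    tight ([tail_le]), and a tight mean agrees with a probability measure on
    bounded Lipschitz functions, in particular on [x |-> 1 / (w - x)]: its
    distribution function, made right-continuous, is that of a probability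
    measure ([mean_representation]). *)

Set Implicit Arguments.
Unset Strict Implicit.
Unset Printing Implicit Defensive.

Import Order.TTheory GRing.Theory Num.Theory.
Import numFieldNormedType.Exports.

Local Open Scope classical_set_scope.
Local Open Scope ring_scope.
Local Open Scope complex_scope.

(** * Boolean powers of finitely supported measures *)

Section FiniteBooleanPower.
Local Open Scope sesquilinear_scope.

(** In an orthonormal eigenbasis of [M], [<xi, (w - M)^-1 xi>] becomes a sum of
    simple fractions with real poles and nonnegative residues. The resolvent
    enters through any solution [v] of [(w - M) v = d xi]; the factor [d] allows
    for a right-hand side which is not known to be nonzero. *)
Lemma hermitian_resolvent (C : numClosedFieldType) (m : nat) (M : 'M[C]_m)
    (xi : 'cV[C]_m) :
  M \is hermsymmx ->
  exists (u : 'cV[C]_m) (lam : 'rV[C]_m),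
    [/\ lam \is a realmx, \sum_k `|u k 0| ^+ 2 = \sum_k `|xi k 0| ^+ 2 &
      forall (w d : C) (v : 'cV[C]_m), w \isn't Num.real ->
        w *: v - M *m v = d *: xi ->
        \sum_k (xi k 0)^* * v k 0 =
          (\sum_k `|u k 0| ^+ 2 / (w - lam 0 k)) * d].
Proof.
move=> Mh.
have /orthomx_spectralP := hermitian_normalmx Mh.
have lamR := hermitian_spectral_diag_real Mh.
move: (spectral_unitarymx M) (spectral_unit M) lamR.
set P := spectralmx M; set lam := spectral_diag M => Pu PU lamR MP.
have isom (x y : 'cV[C]_m) :
    \sum_k ((P *m x) k 0)^* * (P *m y) k 0 = \sum_k (x k 0)^* * y k 0.
  have dotE (a b : 'cV[C]_m) : \sum_k (a k 0)^* * b k 0 = (a^t* *m b) 0 0.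
    by rewrite mxE; apply: eq_bigr => k _; rewrite !mxE.
  rewrite !dotE trmx_mul map_mxM mulmxA -[X in X *m y]mulmxA.
  by rewrite -invmx_unitary// mulVmx// mulmx1.
exists (P *m xi), lam; split => //.
  under eq_bigr do rewrite normCKC.
  by rewrite isom; apply: eq_bigr => k _; rewrite normCKC.
move=> w d v wNR vE.
have PvE : w *: (P *m v) - diag_mx lam *m (P *m v) = d *: (P *m xi).
  rewrite !scalemxAr -vE mulmxBr; congr (_ - _).
  by rewrite [in RHS]MP !mulmxA mulmxV// mul1mx.
rewrite -isom mulr_suml; apply: eq_bigr => k _.
have : w * (P *m v) k 0 - lam 0 k * (P *m v) k 0 = d * (P *m xi) k 0.
  by move/matrixP/(_ k 0): PvE; rewrite mul_diag_mx !mxE.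
rewrite -mulrBl => E.
have wl : w - lam 0 k != 0.
  apply: contra wNR; rewrite subr_eq0 => /eqP ->.
  by move/mxOverP: lamR; apply.
rewrite normCKC; apply: (mulIf wl).
rewrite mulrC mulrCA E [RHS]mulrAC mulfVK//; ring.
Qed.

(** With [A = diag a] and [xi = sqrt p], [G = <xi, (w - A)^-1 xi>]. Let
    [S = 1 + (sqrt t - 1) xi xi^T] and [g = (w - A)^-1 xi]. The vector
    [v = sqrt t g + (1 - sqrt t) G xi] satisfies [S v = sqrt t g], hence
    [(w - S A S) v = ((1 - t) w G + t) xi], while [<xi, v> = G]. So the atoms
    sought are the eigenvalues of [S A S]. The identity is multiplied out in
    order to hold without a hypothesis on the denominator. *)
Lemma boolean_power_finite (R : rcfType) (m : nat) (p a : 'I_m -> R) (t : R) :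
  (forall j, 0 <= p j) -> \sum_j p j = 1 -> 0 <= t ->
  exists c lam : 'I_m -> R,
    [/\ forall k, 0 <= c k, \sum_k c k = 1 &
      forall w : R[i], complex.Im w != 0 ->
        let G := \sum_j (p j)%:C * (w - (a j)%:C)^-1 in
        (\sum_k (c k)%:C * (w - (lam k)%:C)^-1)
          * ((1 - t%:C) * w * G + t%:C) = G].
Proof.
move=> p0 p1 t0.
pose r := (Num.sqrt t)%:C; pose s j := (Num.sqrt (p j))%:C.
have r2 : r * r = t%:C by rewrite -rmorphM -expr2 sqr_sqrtr.
have s2 j : s j * s j = (p j)%:C by rewrite -rmorphM -expr2 sqr_sqrtr.
pose xi : 'cV[R[i]]_m := \col_j s j.
pose S : 'M[R[i]]_m := 1%:M + (r - 1) *: (xi *m xi^T).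
pose A : 'M[R[i]]_m := diag_mx (\row_j (a j)%:C).
have realC (x : R) : x%:C \is Num.real by apply/complex_realP; exists x.
have Mh : S *m A *m S \is hermsymmx.
  have ST : S^T = S.
    by rewrite /S linearD/= trmx1 linearZ/= trmx_mul trmxK.
  apply: realsym_hermsym.
    apply/is_hermitianmxP; rewrite expr0 scale1r map_mx_id//.
    by rewrite !trmx_mul ST tr_diag_mx mulmxA.
  have SR : S \is a mxOver Num.real.
    apply/mxOverP => i j; rewrite !mxE big_ord1 !mxE.
    by rewrite rpredD ?rpredM ?rpredB ?rpred1 ?realC// rpredMn ?rpred1.
  rewrite !mxOverM//; apply/mxOverP => i j.
  by rewrite !mxE rpredMn// realC.
have [u [lam [lamR uxi res]]] := hermitian_resolvent xi Mh.
exists (fun k => complex.Re (`|u k 0| ^+ 2)), (fun k => complex.Re (lam 0 k)).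
have uR k : (complex.Re (`|u k 0| ^+ 2))%:C = `|u k 0| ^+ 2.
  by rewrite RRe_real// realX// normr_real.
have lR k : (complex.Re (lam 0 k))%:C = lam 0 k.
  by rewrite RRe_real//; move/mxOverP: lamR; apply.
split.
- by move=> k; rewrite -lecR uR exprn_ge0.
- apply: (@complexI R); rewrite rmorph_sum/=.
  under eq_bigr do rewrite uR.
  rewrite uxi -p1 rmorph_sum/=; apply: eq_bigr => j _.
  rewrite mxE ger0_norm ?expr2 ?s2//.
  by rewrite /s lecR sqrtr_ge0.
move=> w wI G.
under eq_bigr do rewrite uR lR.
have wNR : w \isn't Num.real.
  by apply: contra wI => /complex_realP[x ->].
pose g : 'cV[R[i]]_m := \col_j (s j / (w - (a j)%:C)).
have wa j : w - (a j)%:C != 0.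
  apply: contra wNR; rewrite subr_eq0 => /eqP ->; exact: realC.
pose v := r *: g + ((1 - r) * G) *: xi.
have xx : xi^T *m xi = 1%:M.
  rewrite [RHS]mx11_scalar; apply/matrixP => i j; rewrite !ord1 !mxE/= mulr1n.
  rewrite -[RHS](rmorph1 (real_complex R)) -p1 rmorph_sum/=.
  by apply: eq_bigr => k _; rewrite !mxE s2.
have xg : xi^T *m g = G%:M.
  apply/matrixP => i j; rewrite !ord1 !mxE/= mulr1n.
  by apply: eq_bigr => k _; rewrite !mxE mulrA s2.
(* [g = (w - A)^-1 xi] *)
have Ag : A *m g = w *: g - xi.
  apply/matrixP => i j; rewrite ord1 mul_diag_mx !mxE.
  rewrite mulrCA mulrA; apply: (mulIf (wa i)).
  by rewrite mulrBl !mulrA !mulfVK//; ring.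
have Sxi : S *m xi = r *: xi.
  rewrite /S mulmxDl mul1mx -scalemxAl -mulmxA xx mulmx1 -[X in X + _]scale1r.
  by rewrite -scalerDl addrC subrK.
have Sg : S *m g = g + ((r - 1) * G) *: xi.
  by rewrite /S mulmxDl mul1mx -scalemxAl -mulmxA xg mul_mx_scalar scalerA.
have := res w ((1 - t%:C) * w * G + t%:C) v wNR.
have -> : \sum_k (xi k 0)^* * v k 0 = G.
  transitivity ((xi^T *m v) 0 0).
    rewrite mxE; apply: eq_bigr => k _; rewrite [in RHS]mxE; congr (_ * _).
    by rewrite mxE; apply/CrealP/realC.
  by rewrite /v mulmxDr -!scalemxAr xg xx !mxE/= !mulr1n; ring.
move=> <- //.
rewrite -!mulmxA.
have -> : S *m v = r *: g.
  rewrite /v mulmxDr -!scalemxAr Sxi Sg scalerDr !scalerA -addrA -scalerDl.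
  rewrite [X in _ + X *: _](_ : _ = 0) ?scale0r ?addr0//.
  by ring.
rewrite -scalemxAr Ag scalerBr mulmxBr scalerA -!scalemxAr Sg Sxi /v -r2.
apply/matrixP => i j; rewrite !mxE; ring.
Qed.

End FiniteBooleanPower.

(** * Means on bounded measurable functions *)

Section Means.
Import HBSimple.
Context {R : realType}.
Implicit Types (f g u : R -> R) (L : (R -> R) -> R).

Definition bounded_measurable f :=
  measurable_fun [set: R] f /\ exists M, forall x, `|f x| <= M.

Lemma bmeas_cst c : bounded_measurable (fun=> c).
Proof. by split; [exact: measurable_cst|exists `|c|]. Qed.

Lemma bmeasD f g : bounded_measurable f -> bounded_measurable g ->
  bounded_measurable (fun x => f x + g x).
Proof.
move=> [mf [M fM]] [mg [N gN]]; split; first exact: measurable_funD.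
by exists (M + N) => x; rewrite (le_trans (ler_normD _ _))// lerD.
Qed.

Lemma bmeasM f g : bounded_measurable f -> bounded_measurable g ->
  bounded_measurable (fun x => f x * g x).
Proof.
move=> [mf [M fM]] [mg [N gN]]; split; first exact: measurable_funM.
by exists (M * N) => x; rewrite normrM ler_pM.
Qed.

Lemma bmeasZ c f : bounded_measurable f ->
  bounded_measurable (fun x => c * f x).
Proof. by move=> bf; exact: bmeasM (bmeas_cst c) bf. Qed.

Lemma bmeasB f g : bounded_measurable f -> bounded_measurable g ->
  bounded_measurable (fun x => f x - g x).
Proof.
move=> bf bg; have -> : (fun x => f x - g x) = (fun x => f x + (-1) * g x).
  by apply/funext => x; rewrite mulN1r.
exact: bmeasD bf (bmeasZ _ bg).
Qed.

Lemma bmeas_sum I (s : seq I) (F : I -> R -> R) :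
  (forall i, bounded_measurable (F i)) ->
  bounded_measurable (fun x => \sum_(i <- s) F i x).
Proof.
move=> bF; elim: s => [|i s IH].
  have -> : (fun x => \sum_(i <- [::]) F i x) = (fun=> 0).
    by apply/funext => x; rewrite big_nil.
  exact: bmeas_cst.
have -> : (fun x => \sum_(j <- i :: s) F j x) =
    (fun x => F i x + \sum_(j <- s) F j x).
  by apply/funext => x; rewrite big_cons.
exact: bmeasD.
Qed.

Lemma bmeas_indic (A : set R) : measurable A -> bounded_measurable (\1_A).
Proof.
move=> mA; split; first exact: measurable_indic.
by exists 1 => x; rewrite indicE; case: (_ \in _); rewrite ?normr1 ?normr0.
Qed.

Lemma bmeas_continuous f M : continuous f -> (forall x, `|f x| <= M) ->
  bounded_measurable f.
Proof. by move=> cf fM; split; [exact: continuous_measurable_fun|exists M]. Qed.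

(** These are the finitely additive probabilities on the Borel sets of the line,
    seen as functionals. Countable additivity would be lost in the ultrafilter
    limits below. *)
Record is_mean L : Prop := IsMean {
  mean1 : L (fun=> 1) = 1;
  meanD : forall f g, bounded_measurable f -> bounded_measurable g ->
    L (fun x => f x + g x) = L f + L g;
  meanZ : forall c f, bounded_measurable f -> L (fun x => c * f x) = c * L f;
  mean_ge0 : forall f, bounded_measurable f -> (forall x, 0 <= f x) ->
    0 <= L f }.

Section MeanTheory.
Variables (L : (R -> R) -> R) (mL : is_mean L).

Lemma mean_cst c : L (fun=> c) = c.
Proof.
have := meanZ mL c (bmeas_cst 1); rewrite (mean1 mL) mulr1 => E.
by rewrite -[RHS]E; congr L; apply/funext => x; rewrite mulr1.
Qed.

Lemma meanB f g : bounded_measurable f -> bounded_measurable g ->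
  L (fun x => f x - g x) = L f - L g.
Proof.
move=> bf bg; have -> : (fun x => f x - g x) = (fun x => f x + (-1) * g x).
  by apply/funext => x; rewrite mulN1r.
by rewrite (meanD mL bf (bmeasZ _ bg)) (meanZ mL _ bg) mulN1r.
Qed.

Lemma mean_sum I (s : seq I) (F : I -> R ->
  R) : (forall i, bounded_measurable (F i)) ->
  L (fun x => \sum_(i <- s) F i x) = \sum_(i <- s) L (F i).
Proof.
move=> bF; elim: s => [|i s IH].
  rewrite big_nil -[RHS]mean_cst; congr L.
  by apply/funext => x; rewrite big_nil.
rewrite big_cons -IH -(meanD mL (bF i) (bmeas_sum s bF)); congr L.
by apply/funext => x; rewrite big_cons.
Qed.

Lemma le_mean f g : bounded_measurable f -> bounded_measurable g ->
  (forall x, f x <= g x) -> L f <= L g.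
Proof.
move=> bf bg fg; rewrite -subr_ge0 -meanB//.
by apply: (mean_ge0 mL); [exact: bmeasB|move=> x; rewrite subr_ge0].
Qed.

Lemma le_norm_mean f g : bounded_measurable f -> bounded_measurable g ->
  (forall x, `|f x| <= g x) ->
  `|L f| <= L g.
Proof.
move=> bf bg fg; rewrite ler_norml; apply/andP; split.
  rewrite lerNl -mulN1r -(meanZ mL _ bf).
  apply: le_mean => //; first exact: bmeasZ.
  by move=> x; rewrite mulN1r (le_trans _ (fg x))// -normrN ler_norm.
by apply: le_mean => // x; rewrite (le_trans _ (fg x))// ler_norm.
Qed.

(** Cauchy-Schwarz, from the positivity of the mean of [(u - L u) ^+ 2]. *)
Lemma mean_sqr_le u : bounded_measurable u -> L u ^+ 2 <= L (fun x => u x ^+ 2).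
Proof.
move=> bu; set c := L u.
have bu2 : bounded_measurable (fun x => u x ^+ 2) by exact: bmeasM.
have : 0 <= L (fun x => (u x ^+ 2 - (2 * c) * u x) + c ^+ 2).
  apply: (mean_ge0 mL).
    exact: bmeasD (bmeasB bu2 (bmeasZ _ bu)) (bmeas_cst _).
  by move=> x; rewrite (_ : _ + _ = (u x - c) ^+ 2) ?sqr_ge0//; ring.
rewrite (meanD mL (bmeasB bu2 (bmeasZ _ bu)) (bmeas_cst _)) mean_cst.
by rewrite meanB ?(meanZ mL)//; [rewrite -/c; lra|exact: bmeasZ].
Qed.

End MeanTheory.

Lemma mean_eval (a : R) : is_mean (fun f => f a).
Proof. by split. Qed.

Lemma mean_convex (I : finType) (p : I -> R) (Lf : I -> (R -> R) -> R) :
  (forall i, 0 <= p i) -> \sum_i p i = 1 -> (forall i, is_mean (Lf i)) ->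
  is_mean (fun f => \sum_i p i * Lf i f).
Proof.
move=> p0 p1 mL; split.
- by under eq_bigr do rewrite (mean1 (mL _)) mulr1.
- move=> f g bf bg; rewrite -big_split/=; apply: eq_bigr => i _.
  by rewrite (meanD (mL _))// mulrDr.
- move=> c f bf; rewrite big_distrr/=; apply: eq_bigr => i _.
  by rewrite (meanZ (mL _))// mulrCA.
- by move=> f bf f0; apply: sumr_ge0 => i _; rewrite mulr_ge0// (mean_ge0 (mL _)).
Qed.

Lemma bmeas_integrable (P : probability (measurableTypeR R) R) f :
  bounded_measurable f -> P.-integrable setT (EFin \o f).
Proof.
move=> [mf [M fM]]; apply: measurable_bounded_integrable => //.
  by rewrite (le_lt_trans (probability_le1 _ _))// ltry.
exists M; split; first by rewrite num_real.
by move=> x Mx y _; rewrite /= (le_trans (fM y))// ltW.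
Qed.

Lemma mean_integral (P : probability (measurableTypeR R) R) :
  is_mean (fun f => \int[P]_x f x).
Proof.
split.
- by rewrite Rintegral_cst// mul1r [X in fine X]probability_setT.
- by move=> f g bf bg; apply: RintegralD => //; exact: bmeas_integrable.
- by move=> c f bf; apply: RintegralZl => //; exact: bmeas_integrable.
- by move=> f bf f0; apply: Rintegral_ge0.
Qed.

(** For each [f] the values [Ln n f] stay in a compact interval, so they converge
    along an ultrafilter, and the algebraic conditions defining means pass to
    the limit. A single ultrafilter serves all [f] at once, which a subsequence
    could not do. *)
Lemma mean_limit (Ln : nat -> (R -> R) -> R) : (forall n, is_mean (Ln n)) ->
  exists (U : set_system nat) L, [/\ UltraFilter U, \oo `<=` U, is_mean L &
    forall f, bounded_measurable f -> Ln n f @[n --> U] --> L f].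
Proof.
move=> mL; have [U [UU ooU]] := @ultraFilterLemma nat \oo _.
have PU : ProperFilter U := @ultra_proper _ _ UU.
have lim_ex f : bounded_measurable f -> exists l : R, Ln n f @[n --> U] --> l.
  move=> bf; have [M fM] := bf.2.
  have Lf n : `[(- M), M]%classic (Ln n f).
    rewrite /= in_itv/= -ler_norml -[leRHS](mean_cst (mL n)).
    by apply: le_norm_mean => //; exact: bmeas_cst.
  have := @segment_compact R (- M) M; rewrite compact_ultra.
  have uf : UltraFilter (Ln ^~ f @ U).
    split=> [|G PG leG]; first exact: fmap_proper_filter.
    apply/seteqP; split=> // A GA.
    have [//|UnA] := in_ultra_setVsetC (Ln ^~ f @^-1` A) UU.
    have /leG GnA : (Ln ^~ f @ U) (~` A) by [].
    by have [? []] := filter_ex (filterI GA GnA).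
  move=> /(_ (Ln ^~ f @ U) uf).
  case=> [|l [_ lim]]; last by exists l.
  by apply: (@filterS _ U _ setT) (@filterT _ U _) => n _; exact: Lf.
have limE f : exists l : R, bounded_measurable f -> Ln n f @[n --> U] --> l.
  by case: (pselect (bounded_measurable f)) => [/lim_ex[l ?]|?]; [exists l|exists 0].
have [L LU] := choice limE.
exists U, L; split => //; split.
- have := LU _ (bmeas_cst 1); under eq_cvg do rewrite (mean1 (mL _)).
  by move=> H; apply: (cvg_unique _ H); [exact: Rhausdorff|exact: cvg_cst].
- move=> f g bf bg; have := LU _ (bmeasD bf bg).
  under eq_cvg do rewrite (meanD (mL _) bf bg).
  move=> H; apply: (cvg_unique _ H); first exact: Rhausdorff.
  by apply: cvgD; exact: LU.
- move=> c f bf; have := LU _ (bmeasZ c bf).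
  under eq_cvg do rewrite (meanZ (mL _) c bf).
  move=> H; apply: (cvg_unique _ H); first exact: Rhausdorff.
  by apply: cvgM; [exact: cvg_cst|exact: LU].
- move=> f bf f0; apply: (@closed_cvg _ _ U PU _ [set x : R | 0 <= x]).
  + exact: closed_ge.
  + by apply: nearW => n; exact: (mean_ge0 (mL n) bf f0).
  + exact: LU.
Qed.


Lemma bounded_cvg_integral (P : probability (measurableTypeR R) R)
    (fn : nat -> R -> R) (f : R -> R) (M : R) :
  (forall n, measurable_fun setT (fn n)) -> (forall n x, `|fn n x| <= M) ->
  (forall x, fn n x @[n --> \oo] --> f x) ->
  \int[P]_x fn n x @[n --> \oo] --> \int[P]_x f x.
Proof.
move=> mfn fnM fnf.
have mf : measurable_fun setT f.
  by apply: (measurable_fun_cvg mfn) => x _; exact: fnf.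
have fM x : `|f x| <= M.
  apply: (@closed_cvg _ _ \oo _ (fun n => `|fn n x|) [set y : R | y <= M]).
  - exact: closed_le.
  - by apply: nearW => n; exact: fnM.
  - by apply: cvg_norm; exact: fnf.
have aefn : {ae P, forall x, setT x -> (EFin \o fn n) x @[n --> \oo] --> (EFin \o f) x}.
  by apply: aeW => x _; apply: cvg_EFin; [exact: nearW|exact: fnf].
have aeM : {ae P, forall x n, setT x -> (`|(EFin \o fn n) x| <= (cst M%:E) x)%E}.
  by apply: aeW => x n _; rewrite /= lee_fin.
have [_ _ H] := @dominated_convergence _ (measurableTypeR R) R P
  setT measurableT (fun n => EFin \o fn n) (EFin \o f) (cst M%:E)
  (fun n => (measurable_EFinP _ _).2 (mfn n)) ((measurable_EFinP _ _).2 mf)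
  aefn (bmeas_integrable P (bmeas_cst M)) aeM.
apply: fine_cvg; rewrite /Rintegral fineK//.
by apply: integrable_fin_num => //; apply: bmeas_integrable; split; [|exists M].
Qed.

(** Integrating a function of a finitely valued [phi n] amounts to a finite
    convex combination of point evaluations, with the same weights and points
    for all integrands, and thus reduces a measure to finite data. *)
Lemma finitely_valued_approximation (P : probability (measurableTypeR R) R) :
  exists phi : nat -> R -> R,
    [/\ forall n, measurable_fun setT (phi n),
      forall x, phi n x @[n --> \oo] --> x &
      forall n, exists (m : nat) (p a : 'I_m -> R),
        [/\ forall j, 0 <= p j, \sum_j p j = 1 &
          forall h : R -> R, bounded_measurable (h \o phi n) /\
            \int[P]_x h (phi n x) = \sum_j p j * h (a j)]].
Proof.
have [g gE] := @approximation_sfun _ (measurableTypeR R) R EFin setT measurableT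
  (@EFin_measurable R setT).
exists (fun n => g n); split.
- by move=> n; exact: (measurable_funPT (g n)).
- by move=> x; apply: fine_cvg (gE x I).
move=> n; have /finite_seqP[s sE] := fimfunP (g n).
pose s' := undup s.
pose E (j : 'I_(size s')) := (g n) @^-1` [set s'`_j].
have mE j : measurable (E j).
  by rewrite -[E j]setTI; apply: measurable_funPT.
(* [undup] lists each value once, so exactly one term of the sum survives. *)
have hE (h : R -> R) x : h (g n x) = \sum_(j < size s') h s'`_j * \1_(E j) x.
  have gs : g n x \in s'.
    rewrite mem_undup; have : [set` s] (g n x) by rewrite -sE; exists x.
    by [].
  have js : (index (g n x) s' < size s')%N by rewrite index_mem.
  rewrite (bigD1 (Ordinal js))//= nth_index// indicE mem_set; last first.
    by rewrite /E /= nth_index.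
  rewrite mulr1 big1 ?addr0// => j jN.
  rewrite indicE memNset ?mulr0// /E/= => gj.
  move/eqP: jN; apply; apply/val_inj => /=.
  by rewrite gj index_uniq// undup_uniq.
pose L f := \int[P]_x f x.
have mL : is_mean L := mean_integral P.
have bE j : bounded_measurable (\1_(E j)) by exact: bmeas_indic (mE j).
have hL (h : R -> R) : L (h \o g n) = \sum_(j < size s') L (\1_(E j)) * h (s'`_j).
  rewrite (_ : h \o g n = fun x => \sum_(j < size s') h s'`_j * \1_(E j) x); last first.
    by apply/funext => x; exact: hE.
  rewrite (mean_sum mL); last by move=> j; exact: bmeasZ.
  by apply: eq_bigr => j _; rewrite (meanZ mL)// mulrC.
exists (size s'), (fun j => L (\1_(E j))), (fun j => s'`_j); split.
- by move=> j; apply: (mean_ge0 mL) => // x; rewrite indicE ler0n.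
- rewrite -(mean1 mL) (_ : (fun=> 1) = (fun=> 1) \o g n)// hL.
  by apply: eq_bigr => j _; rewrite mulr1.
- move=> h; split; last exact: hL.
  rewrite (_ : h \o g n = fun x => \sum_(j < size s') h s'`_j * \1_(E j) x); last first.
    by apply/funext => x; exact: hE.
  by apply: bmeas_sum => j; exact: bmeasZ.
Qed.

End Means.

(** * Tight means are given by probability measures on Lipschitz functions *)

Section Representation.
Context {R : realType}.
Implicit Types (f : R -> R) (L : (R -> R) -> R) (P : probability (measurableTypeR R) R).

Definition mean_cdf L (x : R) := L (\1_(`]-oo, x]%classic)).

Lemma indicle (x y : R) : \1_(`]-oo, x]%classic) y = ((y <= x)%R)%:R :> R.
Proof. by rewrite indicE mem_setE in_itv. Qed.

Lemma bmeas_halfline (x : R) : bounded_measurable (\1_(`]-oo, x]%classic) : R ->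
  R).
Proof. by apply: bmeas_indic; exact: measurable_itv. Qed.

Lemma mean_cdf_nd L : is_mean L -> {homo mean_cdf L : x y / x <= y}.
Proof.
move=> mL x y xy; apply: (le_mean mL); try exact: bmeas_halfline.
by move=> z; rewrite !indicle; case: (leP z x) => zx; rewrite ?ler0n// (le_trans zx xy).
Qed.

Lemma mean_cdf_ge0 L x : is_mean L -> 0 <= mean_cdf L x.
Proof.
move=> mL; apply: (mean_ge0 mL); first exact: bmeas_halfline.
by move=> z; rewrite indicle ler0n.
Qed.

Lemma mean_cdf_le1 L x : is_mean L -> mean_cdf L x <= 1.
Proof.
move=> mL; rewrite -(mean1 mL); apply: (le_mean mL).
- exact: bmeas_halfline.
- exact: bmeas_cst.
- by move=> z; rewrite indicle lern1 leq_b1.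
Qed.

(** Approximation of [f] by a step function on the grid [a + i d]: between grid
    points the error is controlled by the Lipschitz constant, and outside of the
    grid by the bound on [f]. *)
Lemma mean_step_approx L f (M C a d : R) (m : nat) :
  let x i := a + i%:R * d in
  is_mean L -> bounded_measurable f -> (forall y, `|f y| <= M) ->
  (forall y z, `|f y - f z| <= C * `|y - z|) -> 0 <= C -> 0 <= d ->
  `|L f - \sum_(i < m) f (x i) * (mean_cdf L (x i.+1) - mean_cdf L (x i))| <=
    C * d + M * (mean_cdf L (x 0%N) + (1 - mean_cdf L (x m))).
Proof.
move=> x mL bf fM fC C0 d0.
pose g y : R := \sum_(i < m) f (x i) * (\1_(`]-oo, x i.+1]) y - \1_(`]-oo, x i]) y).
pose h y : R := C * d + M * (\1_(`]-oo, x 0%N]) y + (1 - \1_(`]-oo, x m]) y)).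
have bI i : bounded_measurable (\1_(`]-oo, x i]) : R -> R) by exact: bmeas_halfline.
have bt i : bounded_measurable (fun y => f (x i) * (\1_(`]-oo, x i.+1]) y - \1_(`]-oo, x i]) y)).
  by apply: bmeasZ; exact: bmeasB.
have Lg : L g = \sum_(i < m) f (x i) * (mean_cdf L (x i.+1) - mean_cdf L (x i)).
  rewrite /g (mean_sum mL _ (fun i : 'I_m => bt i)); apply: eq_bigr => i _.
  by rewrite (meanZ mL) ?(meanB mL)//; exact: bmeasB.
have bg : bounded_measurable g by apply: (bmeas_sum _ (fun i : 'I_m => bt i)).
have b1 : bounded_measurable (fun y => 1 - \1_(`]-oo, x m]) y : R).
  by apply: bmeasB; [exact: bmeas_cst|].
have Lh : L h = C * d + M * (mean_cdf L (x 0%N) + (1 - mean_cdf L (x m))).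
  rewrite /h (meanD mL (bmeas_cst _) (bmeasZ _ (bmeasD (bI _) b1))).
  rewrite (mean_cst mL) (meanZ mL _ (bmeasD (bI _) b1)) (meanD mL (bI _) b1).
  by rewrite (meanB mL (bmeas_cst _) (bI _)) (mean_cst mL).
rewrite -Lg -Lh -(meanB mL bf bg).
apply: (le_norm_mean mL); first exact: bmeasB.
  exact: bmeasD (bmeas_cst _) (bmeasZ _ (bmeasD (bI _) b1)).
move=> y; rewrite /g /h !indicle.
have M0 : 0 <= M := le_trans (normr_ge0 _) (fM 0).
have x_nd i j : (i <= j)%N -> x i <= x j.
  by move=> ij; rewrite lerD2l ler_wpM2r// ler_nat.
(* To the left of [x m] a further cell changes neither side; to its right, it is
   the only cell that can contain [y]. *)
elim: m {g h bt Lg bg b1 Lh} => [|m IH].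
  by rewrite big_ord0 subr0 subrKC mulr1 (le_trans (fM y))// lerDr mulr_ge0.
rewrite big_ord_recr/= !indicle; have [yx|yx] := leP y (x m).
  have yx' : y <= x m.+1 by rewrite (le_trans yx)// x_nd.
  move: IH; rewrite yx yx' !subrr mulr0 !addr0; exact: le_trans.
have yF j : (j <= m)%N -> (y <= x j) = false.
  by move=> jm; rewrite leNgt (le_lt_trans (x_nd _ _ jm) yx).
rewrite big1 ?add0r; last first.
  by move=> i _; rewrite !indicle !yF ?subrr ?mulr0// ltnW.
rewrite (yF 0%N)//.
rewrite add0r; have [yx'|yx'] := leP y (x m.+1).
  rewrite subrr mulr0 addr0 subr0 mulr1 (le_trans (fC _ _))// ler_wpM2l//.
  rewrite gtr0_norm ?subr_gt0// lerBlDl (le_trans yx')//.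
  by rewrite /x -natr1 mulrDl mul1r addrA.
by rewrite subrr mulr0 !subr0 mulr1 (le_trans (fM y))// lerDr mulr_ge0.
Qed.

Lemma abel_summation (u e : nat -> R) (m : nat) :
  \sum_(i < m) u i * (e i.+1 - e i) =
  u m * e m - u 0%N * e 0%N - \sum_(i < m) (u i.+1 - u i) * e i.+1.
Proof.
elim: m => [|m IH]; first by rewrite !big_ord0; ring.
by rewrite !big_ord_recr/= IH; ring.
Qed.

(** A mean determines its distribution function only up to right limits, hence
    the interlacing hypothesis. On a grid of step [e], the differences [h i] of
    the two distribution functions are nonnegative and bounded by the increment
    over the next cell, so their sum is at most 1. After a summation by parts
    against a Lipschitz function they contribute only [C * e] and two boundary
    terms, small by tightness. This avoids any choice of continuity points. *)
Lemma mean_interlace L L' f (M C : R) :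
  is_mean L -> is_mean L' ->
  (forall x y, x < y -> mean_cdf L x <= mean_cdf L' x <= mean_cdf L y) ->
  (forall e, 0 < e -> exists y,
     mean_cdf L (- y) <= e /\ 1 - mean_cdf L y <= e) ->
  bounded_measurable f -> (forall y, `|f y| <= M) ->
  (forall y z, `|f y - f z| <= C * `|y - z|) -> 0 <= C ->
  L' f = L f.
Proof.
move=> mL mL' FG tight bf fM fC C0.
have M0 : 0 <= M := le_trans (normr_ge0 _) (fM 0).
suff main e : 0 < e -> `|L' f - L f| <= (3 * C + 6 * M) * e.
  apply/eqP; rewrite -subr_eq0 -normr_le0; apply/ler_addgt0Pr => e e0.
  rewrite add0r.
  pose K := 3 * C + 6 * M + 1; have K0 : 0 < K by rewrite /K; lra.
  apply: (le_trans (main (e / K) _)); first by rewrite divr_gt0.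
  by rewrite mulrA ler_pdivrMr// mulrC ler_wpM2l ?ltW// /K; lra.
move=> e0; have [y [Fy1 Fy2]] := tight e e0.
set F := mean_cdf L; set G := mean_cdf L'.
pose m := (Num.bound `|2 * y / e|).+1.
(* The grid starts one step before [- y], so that [h 0] too is bounded by the
   increment of [F] over a cell in the left tail. *)
pose x (i : nat) := (- y - e) + i%:R * e.
have x1 : x 1%N = - y by rewrite /x mul1r subrK.
have xE i : x i.+1 = x i + e by rewrite /x -natr1 mulrDl mul1r addrA.
have xS i : x i < x i.+1 by rewrite xE ltrDl.
have xm : y <= x m.
  have := archi_boundP (normr_ge0 (2 * y / e)).
  rewrite /x /m -(natr1 (Num.bound _)); set N := (Num.bound _)%:R => NE.
  have : 2 * y / e < N by exact: le_lt_trans (ler_norm _) NE.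
  rewrite ltr_pdivrMr// mulrDl mul1r; lra.
pose SL := \sum_(i < m) f (x i) * (F (x i.+1) - F (x i)).
pose SL' := \sum_(i < m) f (x i) * (G (x i.+1) - G (x i)).
have B : `|L f - SL| <= C * e + M * (F (x 0%N) + (1 - F (x m))).
  exact: (mean_step_approx (- y - e) m mL bf fM fC C0 (ltW e0)).
have B' : `|L' f - SL'| <= C * e + M * (G (x 0%N) + (1 - G (x m))).
  exact: (mean_step_approx (- y - e) m mL' bf fM fC C0 (ltW e0)).
pose h i := G (x i) - F (x i).
have h0 i : 0 <= h i by rewrite subr_ge0; case/andP: (FG _ _ (xS i)).
have hF i : h i <= F (x i.+1) - F (x i).
  by rewrite lerD2r; case/andP: (FG _ _ (xS i)).
have SE : SL' - SL = f (x m) * h m - f (x 0%N) * h 0%N -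
    \sum_(i < m) (f (x i.+1) - f (x i)) * h i.+1.
  rewrite -(abel_summation (fun i => f (x i)) h) -sumrB.
  by apply: eq_bigr => i _; rewrite /h; ring.
have Fx1 : F (x m.+1) <= 1 by exact: mean_cdf_le1.
have Fx2 : 0 <= F (x 1%N) by exact: mean_cdf_ge0.
have Fx3 : 0 <= F (x 0%N) by exact: mean_cdf_ge0.
have Fx4 : F (x 0%N) <= F (x 1%N) by apply: mean_cdf_nd => //; exact/ltW.
have Fx5 : F (x 1%N) <= e by rewrite x1.
have Fx6 : 1 - F (x m) <= e.
  by apply: le_trans Fy2; rewrite lerD2l lerN2; exact: mean_cdf_nd.
have S3 : `|\sum_(i < m) (f (x i.+1) - f (x i)) * h i.+1| <= C * e.
  apply: (le_trans (ler_norm_sum _ _ _)).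
  apply: (@le_trans _ _ (\sum_(i < m) C * e * (F (x i.+2) - F (x i.+1)))).
    apply: ler_sum => i _; rewrite normrM (ger0_norm (h0 _)).
    apply: ler_pM => //; rewrite (le_trans (fC _ _))//.
    by rewrite xE addrC addKr gtr0_norm.
  rewrite -big_distrr/= -(big_mkord xpredT (fun i => F (x i.+2) - F (x i.+1))).
  rewrite (telescope_sumr (fun i => F (x i.+1)))// ler_piMr//.
    by rewrite mulr_ge0// ltW.
  lra.
have S1 : `|f (x m) * h m| <= M * e.
  rewrite normrM (ger0_norm (h0 _)) ler_pM//.
  by apply: le_trans (hF m) _; lra.
have S2 : `|f (x 0%N) * h 0%N| <= M * e.
  rewrite normrM (ger0_norm (h0 _)) ler_pM//.
  by apply: le_trans (hF 0%N) _; lra.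
have B1 : `|L f - SL| <= C * e + M * (2 * e).
  apply: le_trans B _; rewrite lerD2l ler_wpM2l//; lra.
have B1' : `|L' f - SL'| <= C * e + M * (2 * e).
  apply: le_trans B' _; rewrite lerD2l ler_wpM2l//.
  have := h0 m; have := hF 0%N; rewrite /h; lra.
rewrite (_ : L' f - L f = (L' f - SL') - (L f - SL) + (SL' - SL)); last by ring.
apply: le_trans (ler_normD _ _) _.
have D1 : `|SL' - SL| <= M * e + M * e + C * e.
  rewrite SE; apply: le_trans (ler_normB _ _) _; rewrite lerD//.
  by apply: le_trans (ler_normB _ _) _; rewrite lerD.
have D2 := ler_normB (L' f - SL') (L f - SL).
lra.
Qed.


Lemma stieltjes_probability (F : R -> R) :
  {homo F : x y / x <= y} -> right_continuous F ->
  F x @[x --> -oo] --> (0 : R) -> F x @[x --> +oo] --> (1 : R) ->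
  exists P, forall x, mean_cdf (fun f => \int[P]_y f y) x = F x.
Proof.
move=> nd rc lN lp.
pose cF : cumulativeBounded (0 : R) (1 : R) := HB.pack F
  (isCumulative.Build R _ R F nd rc) (isCumulativeBounded.Build R 0 1 F lN lp).
exists (lebesgue_stieltjes_measure cF) => x.
have := cdf_lebesgue_stieltjes_id cF x.
rewrite /cdf /distribution /pushforward preimage_id => E.
by rewrite /mean_cdf /Rintegral integral_indic// setIT; exact: (congr1 fine E).
Qed.

(** The right-continuous regularization [G] of the distribution function [F] of
    [L] satisfies [F x <= G x <= F y] for [x < y], and tightness gives the right
    limits at infinity. The Stieltjes measure of [G] is then compared to [L] by
    [mean_interlace]. *)
Lemma mean_representation L : is_mean L ->
  (forall e, 0 < e -> exists y,
     L (\1_[set x : R | y <= `|x|]) <= e) ->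
  exists P, forall f, bounded_measurable f ->
    (exists C, forall y z, `|f y - f z| <= C * `|y - z|) ->
    \int[P]_x f x = L f.
Proof.
move=> mL tight.
pose F := mean_cdf L.
pose G x := inf [set F y | y in `]x, +oo[%classic].
have ne x : [set F y | y in `]x, +oo[%classic] !=set0.
  by exists (F (x + 1)), (x + 1) => //=; rewrite in_itv/= andbT ltrDl.
have lb x : has_lbound [set F y | y in `]x, +oo[%classic].
  by exists 0 => _ [y _ <-]; exact: mean_cdf_ge0.
have FG x : F x <= G x.
  apply: lb_le_inf => // _ [y xy <-].
  by apply: mean_cdf_nd => //; move: xy; rewrite /= in_itv/= andbT; exact: ltW.
have GF x y : x < y -> G x <= F y.
  by move=> xy; apply: ge_inf => //; exists y => //=; rewrite in_itv/= andbT.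
have Gnd : {homo G : x y / x <= y}.
  move=> x y; case: (ltgtP x y) => [xy _|//|-> //].
  exact: le_trans (GF _ _ xy) (FG _).
have tight' e : 0 < e -> exists y, F (- y) <= e /\ 1 - F y <= e.
  move=> e0; have [y Ly] := tight e e0; exists y.
  have mA : measurable [set x : R | y <= `|x|].
    rewrite -[X in measurable X]setTI.
    by apply: measurable_fun_le => //; exact: measurableT_comp.
  have bA := bmeas_indic mA.
  have AE z : \1_[set x : R | y <= `|x|] z = (y <= `|z|)%R%:R :> R.
    by rewrite indicE mem_setE.
  split; apply: le_trans Ly.
    apply: (le_mean mL) => [||z]; rewrite ?indicle//; first exact: bmeas_halfline.
    rewrite AE; case: (leP z (- y)) => zy; rewrite ?ler0n//.
    by rewrite ler_normr (_ : y <= - z) ?orbT// lerNr.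
  rewrite -(mean1 mL) -(meanB mL (bmeas_cst _) (bmeas_halfline _)).
  apply: (le_mean mL) => [||z] //.
    by apply: bmeasB; [exact: bmeas_cst|exact: bmeas_halfline].
  rewrite AE indicle; case: (leP z y) => zy; rewrite ?subrr ?ler0n// subr0.
  by rewrite ler_normr (ltW zy).
have [P PG] : exists P, forall x, mean_cdf (fun f => \int[P]_y f y) x = G x.
  apply: stieltjes_probability => //.
  - move=> x; apply/cvgrPdist_le => e e0.
    have [_ [y + <-] Fy] := @inf_adherent _ _ e e0 (conj (ne x) (lb x)).
    rewrite /= in_itv/= andbT => xy.
    near=> z.
    rewrite distrC ger0_norm ?subr_ge0; last by apply: Gnd; apply: ltW; near: z; exact: nbhs_right_gt.
    rewrite lerBlDl (le_trans _ (ltW Fy))//.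
    by apply: GF; near: z; exact: nbhs_right_lt.
  - apply/cvgrPdist_le => e e0; have [y [Fy1 _]] := tight' e e0.
    near=> z; rewrite sub0r normrN ger0_norm; last exact: le_trans (mean_cdf_ge0 z mL) (FG z).
    apply: le_trans Fy1; apply: GF; near: z; apply: nbhs_ninfty_lt; exact: num_real.
  - apply/cvgrPdist_le => e e0; have [y [_ Fy2]] := tight' e e0.
    near=> z; rewrite ger0_norm; last first.
      by rewrite subr_ge0 (le_trans (GF z (z + 1) _)) ?ltrDl ?mean_cdf_le1.
    apply: le_trans Fy2; rewrite lerD2l lerN2; apply: le_trans (FG _).
    by apply: mean_cdf_nd => //; near: z; apply: nbhs_pinfty_ge; exact: num_real.
exists P => f bf [C fC].
have [M fM] := bf.2.
apply: (mean_interlace mL (mean_integral P) _ tight' bf fM (C := `|C|)) => //.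
- by move=> x y xy; rewrite PG FG GF.
- by move=> y z; rewrite (le_trans (fC y z))// ler_wpM2r// ler_norm.
Unshelve. all: by end_near.
Qed.

End Representation.

(** * Complex numbers: coordinates and limits *)

Local Notation Re := complex.Re.
Local Notation Im := complex.Im.

Section Complex.
Context {R : realType}.
Implicit Types (z w : R[i]).

Lemma Re_inv z : Re z^-1 = Re z / (Re z ^+ 2 + Im z ^+ 2).
Proof. by case: z. Qed.

Lemma Im_inv z : Im z^-1 = - (Im z / (Re z ^+ 2 + Im z ^+ 2)).
Proof. by case: z. Qed.

Lemma ReM z w : Re (z * w) = Re z * Re w - Im z * Im w.
Proof. by case: z; case: w. Qed.

Lemma ImM z w : Im (z * w) = Re z * Im w + Im z * Re w.
Proof. by case: z; case: w. Qed.

Lemma ReD z w : Re (z + w) = Re z + Re w.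
Proof. by case: z; case: w. Qed.

Lemma ImD z w : Im (z + w) = Im z + Im w.
Proof. by case: z; case: w. Qed.

Lemma ReN z : Re (- z) = - Re z.
Proof. by case: z. Qed.

Lemma ImN z : Im (- z) = - Im z.
Proof. by case: z. Qed.

Lemma complex_ext z w : Re z = Re w -> Im z = Im w -> z = w.
Proof. by case: z; case: w => /= a b c d -> ->. Qed.

(** Complex limits are taken coordinatewise: both integrals and means act on real
    and imaginary parts separately. *)
Definition ccvg (T : Type) (F : set_system T) (u : T -> R[i]) (l : R[i]) :=
  Re (u x) @[x --> F] --> Re l /\ Im (u x) @[x --> F] --> Im l.

Section ccvg_theory.
Context (T : Type) (F : set_system T) {FF : ProperFilter F}.
Implicit Types (u v : T -> R[i]).

Lemma ccvg_cst l : ccvg F (fun=> l) l.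
Proof. by split; exact: cvg_cst. Qed.

Lemma ccvgD u v l k :
  ccvg F u l -> ccvg F v k -> ccvg F (fun x => u x + v x) (l + k).
Proof.
move=> [ul1 ul2] [vk1 vk2]; split.
  by rewrite ReD; under eq_cvg do rewrite ReD; exact: cvgD.
by rewrite ImD; under eq_cvg do rewrite ImD; exact: cvgD.
Qed.

Lemma ccvgM u v l k :
  ccvg F u l -> ccvg F v k -> ccvg F (fun x => u x * v x) (l * k).
Proof.
move=> [ul1 ul2] [vk1 vk2]; split.
  by rewrite ReM; under eq_cvg do rewrite ReM; apply: cvgB; exact: cvgM.
by rewrite ImM; under eq_cvg do rewrite ImM; apply: cvgD; exact: cvgM.
Qed.

Lemma normsq_neq0 z : z != 0 -> Re z ^+ 2 + Im z ^+ 2 != 0.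
Proof.
apply: contra; rewrite paddr_eq0 ?sqr_ge0// !sqrf_eq0 => /andP[/eqP a /eqP b].
by apply/eqP; exact: complex_ext.
Qed.

Lemma ccvgV u l : l != 0 -> ccvg F u l -> ccvg F (fun x => (u x)^-1) l^-1.
Proof.
move=> l0 [ul1 ul2].
have N : Re (u x) ^+ 2 + Im (u x) ^+ 2 @[x --> F] --> Re l ^+ 2 + Im l ^+ 2.
  by apply: cvgD; apply: cvgM.
split.
  rewrite Re_inv; under eq_cvg do rewrite Re_inv.
  by apply: cvgM => //; apply: cvgV => //; exact: normsq_neq0.
rewrite Im_inv; under eq_cvg do rewrite Im_inv.
apply: cvgN; apply: cvgM => //; apply: cvgV => //; exact: normsq_neq0.
Qed.

Lemma ccvg_unique u l k : ccvg F u l -> ccvg F u k -> l = k.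
Proof.
move=> [ul1 ul2] [uk1 uk2].
by apply: complex_ext; [apply: (cvg_unique _ ul1 uk1)|apply: (cvg_unique _ ul2 uk2)];
  exact: Rhausdorff.
Qed.

End ccvg_theory.

Lemma ccvg_sub (T : Type) (F G : set_system T) u l :
  G `<=` F -> ccvg G u l -> ccvg F u l.
Proof. by move=> GF [a b]; split; apply: cvg_trans; [|exact: a| |exact: b]; exact: cvg_app. Qed.

Lemma ccvg_real (x : R) : ccvg (nbhs x) (fun y => y%:C) x%:C.
Proof. by split; [exact: cvg_id|exact: cvg_cst]. Qed.

Lemma Im_neq0 w : Im w != 0 -> w != 0.
Proof. by apply: contra => /eqP ->. Qed.

Lemma normr_Re_le z (b : R) : `|z| <= b%:C -> `|Re z| <= b.
Proof. by move=> h; rewrite -lecR (le_trans _ h)// normc_ge_Re. Qed.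

Lemma normi_eq1 : `|'i%C : R[i]| = 1.
Proof. by rewrite normc_def/= expr0n expr1n add0r sqrtr1. Qed.

Lemma normr_Im_le z (b : R) : `|z| <= b%:C -> `|Im z| <= b.
Proof.
move=> h; have := @normr_Re_le (z * 'i) b.
by rewrite ReiNIm normrN; apply; rewrite normrM normi_eq1 mulr1.
Qed.

Lemma normr_Im_ge w : `|Im w|%:C <= `|w|.
Proof.
by have := normc_ge_Re (w * 'i); rewrite ReiNIm normrN normrM normi_eq1 mulr1.
Qed.

Lemma norm_inv_le w (b : R) : 0 < b -> b <= `|Im w| -> `|w^-1| <= (b^-1)%:C.
Proof.
move=> b0 bw; rewrite normfV fmorphV/= lef_pV2 ?posrE.
- by rewrite (le_trans _ (normr_Im_ge w))// lecR.
- by rewrite normr_gt0 Im_neq0// -normr_gt0 (lt_le_trans b0).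
- by rewrite ltcR.
Qed.

End Complex.

(** * Cauchy transforms of means *)

Section Cauchy.
Context {R : realType}.
Implicit Types (z w : R[i]) (L : (R -> R) -> R) (P : probability (measurableTypeR R) R).

Definition cauchy_mean L w : R[i] :=
  L (fun x => Re (w - x%:C)^-1) +i* L (fun x => Im (w - x%:C)^-1).

Lemma Im_sub_real w (x : R) : Im (w - x%:C) = Im w.
Proof. by rewrite ImD ImN/= oppr0 addr0. Qed.

Lemma Re_sub_real w (x : R) : Re (w - x%:C) = Re w - x.
Proof. by rewrite ReD ReN. Qed.

Lemma sub_real_neq0 w (x : R) : Im w != 0 -> w - x%:C != 0.
Proof. by move=> w0; rewrite Im_neq0// Im_sub_real. Qed.

Lemma kernel_ccvg w (x : R) : Im w != 0 ->
  ccvg (nbhs x) (fun y => (w - y%:C)^-1) (w - x%:C)^-1.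
Proof.
move=> w0; apply: ccvgV; first exact: sub_real_neq0.
have -> : (fun y : R => w - y%:C) = (fun y => w + (-1) * y%:C).
  by apply/funext => y; rewrite mulN1r.
rewrite -[- x%:C]mulN1r; apply: ccvgD; first exact: ccvg_cst.
by apply: ccvgM; [exact: ccvg_cst|exact: ccvg_real].
Qed.

Lemma kernel_bounded w (x : R) : Im w != 0 ->
  `|(w - x%:C)^-1| <= (`|Im w|^-1)%:C.
Proof. by move=> w0; apply: norm_inv_le; rewrite ?normr_gt0// Im_sub_real. Qed.

Lemma bmeas_Re_kernel w : Im w != 0 ->
  bounded_measurable (fun x : R => Re (w - x%:C)^-1).
Proof.
move=> w0; apply: (bmeas_continuous (M := `|Im w|^-1)).
  by move=> x; have [] := kernel_ccvg x w0.
by move=> x; exact: normr_Re_le (kernel_bounded x w0).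
Qed.

Lemma bmeas_Im_kernel w : Im w != 0 ->
  bounded_measurable (fun x : R => Im (w - x%:C)^-1).
Proof.
move=> w0; apply: (bmeas_continuous (M := `|Im w|^-1)).
  by move=> x; have [] := kernel_ccvg x w0.
by move=> x; exact: normr_Im_le (kernel_bounded x w0).
Qed.

Lemma kernel_lipschitz w (x y : R) : Im w != 0 ->
  `|(w - x%:C)^-1 - (w - y%:C)^-1| <= (`|Im w|^-1 * `|Im w|^-1 * `|x - y|)%:C.
Proof.
move=> w0; have xw := sub_real_neq0 x w0; have yw := sub_real_neq0 y w0.
have -> : (w - x%:C)^-1 - (w - y%:C)^-1 =
    (w - x%:C)^-1 * (w - y%:C)^-1 * (x - y)%:C.
  by rewrite rmorphB/=; field; rewrite xw yw.
have dE : `|(x - y)%:C| = `|x - y|%:C :> R[i].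
  by rewrite normc_def/= expr0n addr0 sqrtr_sqr.
rewrite !normrM dE !rmorphM/=.
by rewrite ler_wpM2r ?lecR// ler_pM// kernel_bounded.
Qed.

Lemma cauchy_mean_representation L : is_mean L ->
  (forall e, 0 < e -> exists y, L (\1_[set x : R | y <= `|x|]) <= e) ->
  exists P, forall w, Im w != 0 -> Gtransform P w = cauchy_mean L w.
Proof.
move=> mL tight; have [P PL] := mean_representation mL tight.
exists P => w w0; apply: complex_ext; apply: PL.
- exact: bmeas_Re_kernel.
- exists (`|Im w|^-1 * `|Im w|^-1) => x y.
  rewrite -ReN -ReD; exact: normr_Re_le (kernel_lipschitz _ _ w0).
- exact: bmeas_Im_kernel.
- exists (`|Im w|^-1 * `|Im w|^-1) => x y.
  rewrite -ImN -ImD; exact: normr_Im_le (kernel_lipschitz _ _ w0).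
Qed.

(** For [w = i y], [1 + y Im (1 / (w - x)) = x^2 / (x^2 + y^2)], and this is at
    least 1/2 where [|x| >= y]. *)
Lemma tail_le L (y : R) : is_mean L -> 0 < y ->
  L (\1_[set x : R | y <= `|x|]) <= 2 * (1 + y * Im (cauchy_mean L (y *i))).
Proof.
move=> mL y0; have wI : Im (y *i) != 0 by rewrite /= gt_eqF.
have bI := bmeas_Im_kernel wI.
have -> : 2 * (1 + y * Im (cauchy_mean L (y*i))) =
    L (fun x => 2 * (1 + y * Im (y*i - x%:C)^-1)).
  rewrite (meanZ mL _ (bmeasD (bmeas_cst _) (bmeasZ _ bI))).
  by rewrite (meanD mL (bmeas_cst _) (bmeasZ _ bI)) (meanZ mL _ bI) (mean1 mL).
apply: (le_mean mL).
- apply: bmeas_indic; rewrite -[X in measurable X]setTI.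
  by apply: measurable_fun_le => //; exact: measurableT_comp.
- exact: bmeasZ (bmeasD (bmeas_cst _) (bmeasZ _ bI)).
move=> x; rewrite Im_inv Im_sub_real Re_sub_real/= sub0r sqrrN.
have d0 : 0 < x ^+ 2 + y ^+ 2 by rewrite ltr_wpDl ?sqr_ge0// exprn_gt0.
have -> : 2 * (1 + y * - (y / (x ^+ 2 + y ^+ 2))) = 2 * x ^+ 2 / (x ^+ 2 + y ^+ 2).
  by field; rewrite gt_eqF.
have -> : \1_[set z : R | y <= `|z|] x = (y <= `|x|)%R%:R :> R.
  by rewrite indicE mem_setE.
case: (leP y `|x|) => yx; last first.
  by apply: divr_ge0; [rewrite mulr_ge0 ?sqr_ge0|exact: ltW].
rewrite ler_pdivlMr// mul1r.
have : y ^+ 2 <= x ^+ 2 by rewrite -[leRHS]real_normK ?num_real// lerXn2r ?nnegrE// ltW.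
lra.
Qed.

Lemma cauchy_convex (I : finType) (p a : I -> R) w :
  cauchy_mean (fun f => \sum_j p j * f (a j)) w =
  \sum_j (p j)%:C * (w - (a j)%:C)^-1.
Proof.
apply: complex_ext => /=.
  rewrite (big_morph (@Re R) (@ReD R) (erefl _)); apply: eq_bigr => j _.
  by rewrite ReM/= mul0r subr0.
rewrite (big_morph (@Im R) (@ImD R) (erefl _)); apply: eq_bigr => j _.
by rewrite ImM/= mul0r addr0.
Qed.

Lemma probability_integral_gt0 P (k : R -> R) : bounded_measurable k ->
  (forall x, 0 < k x) ->
  0 < \int[P]_x k x.
Proof.
move=> bk k0.
have K0 : 0 <= \int[P]_x k x by apply: Rintegral_ge0 => x _; exact: ltW.
rewrite lt_neqAle K0 andbT; apply/negP => /eqP K.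
have mk : measurable_fun (setT : set (measurableTypeR R)) (EFin \o k).
  by apply/measurable_EFinP; exact: bk.1.
(* Otherwise [k] vanishes almost everywhere, although it vanishes nowhere. *)
have int0 : (\int[P]_x `|(EFin \o k) x| = 0)%E.
  under eq_integral do rewrite /= gtr0_norm//.
  rewrite -[LHS]fineK; last exact: integrable_fin_num (bmeas_integrable P bk).
  by rewrite -/(Rintegral P setT k) -K.
have [N [mN N0 subN]] := (ae_eq_integral_abs P measurableT mk).1 int0.
have : P setT = 0.
  apply/eqP; rewrite eq_le measure_ge0 andbT -N0 le_measure ?inE//.
  move=> x _; apply: subN => /= /(_ I) [].
  by apply/eqP; rewrite gt_eqF.
by rewrite probability_setT => /eqP; rewrite onee_eq0.
Qed.

(** With [k x = 1 / |w - x|^2], the imaginary part of [G] is [- Im w] times the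
    integral of [k], while [|G|^2] is at most that integral by Cauchy-Schwarz.
    Hence [Im (1 / G) = - Im G / |G|^2 >= Im w]. *)
Lemma reciprocal_Gtransform P w : 0 < Im w ->
  Gtransform P w != 0 /\ Im w <= Im (Gtransform P w)^-1.
Proof.
move=> w0; have wI : Im w != 0 by rewrite gt_eqF.
have bR := bmeas_Re_kernel wI; have bI := bmeas_Im_kernel wI.
have mP : is_mean _ := mean_integral P.
pose k x : R := ((Re w - x) ^+ 2 + Im w ^+ 2)^-1.
have ImE x : Im (w - x%:C)^-1 = - Im w * k x.
  by rewrite Im_inv Im_sub_real Re_sub_real mulNr.
have kE : k = fun x => - (Im w)^-1 * Im (w - x%:C)^-1.
  by apply/funext => x; rewrite ImE mulrA mulrNN mulVf// mul1r.
have d0 x : 0 < (Re w - x) ^+ 2 + Im w ^+ 2.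
  by rewrite ltr_wpDl ?sqr_ge0// exprn_gt0.
have bk : bounded_measurable k by rewrite kE; exact: bmeasZ.
have kE2 : k = fun x => Re (w - x%:C)^-1 ^+ 2 + Im (w - x%:C)^-1 ^+ 2.
  apply/funext => x; rewrite ImE Re_inv Im_sub_real Re_sub_real -/(k x) /k.
  by field; rewrite gt_eqF.
set K := \int[P]_x k x.
have K0 : 0 < K by apply: probability_integral_gt0 => // x; rewrite invr_gt0.
set G := Gtransform P w.
have GI : Im G = - Im w * K.
  rewrite /K -(meanZ mP _ bk) /=; apply: eq_Rintegral => x _; exact: ImE.
have GK : Re G ^+ 2 + Im G ^+ 2 <= K.
  have bR2 := bmeasM bR bR; have bI2 := bmeasM bI bI.
  rewrite /K kE2 (meanD mP bR2 bI2) lerD//.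
    exact: (mean_sqr_le mP bR).
  exact: (mean_sqr_le mP bI).
have G0 : G != 0 by rewrite Im_neq0// GI mulf_neq0 ?oppr_eq0// gt_eqF.
split => //; have n0 : 0 < Re G ^+ 2 + Im G ^+ 2.
  by rewrite lt_neqAle eq_sym normsq_neq0// addr_ge0 ?sqr_ge0.
have NI : - Im G = Im w * K by rewrite GI mulNr opprK.
by rewrite Im_inv -mulNr ler_pdivlMr// NI ler_wpM2l// ltW.
Qed.

End Cauchy.

(** * Means with prescribed Cauchy transform *)

Section Construction.
Context {R : realType}.
Implicit Types (z w : R[i]) (L : (R -> R) -> R) (P : probability (measurableTypeR R) R).

(** The Cauchy transform of the [t]-th Boolean convolution power of [P]: its
    reciprocal is affine in [t], equal to [w] at 0 and to that of [P] at 1. *)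
Definition boolean_power_cauchy P (t : R) w : R[i] :=
  ((1 - t%:C) * w + t%:C * (Gtransform P w)^-1)^-1.

(** The right-hand side is [Im w + t Im (1 / G - w)], and [Im (1 / G - w) >= 0].
    The bound is uniform in [t], which allows for dominated convergence in [t]
    although [t] is unbounded. *)
Lemma power_denominator_Im P (t : R) w : 0 < Im w -> 0 <= t ->
  Im w <= Im ((1 - t%:C) * w + t%:C * (Gtransform P w)^-1).
Proof.
move=> w0 t0; have [_ GI] := reciprocal_Gtransform P w0.
rewrite ImD !ImM ReD ImD ReN ImN/= !(oppr0, addr0, mul0r).
by rewrite mulrBl mul1r -addrA lerDl addrC -mulrBr mulr_ge0// subr_ge0.
Qed.

(** The finitely supported case applied to the images of [P] under finitely valued
    approximations of the identity, followed by a limit of means. *)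
Lemma boolean_power_mean P (t : R) : 0 <= t ->
  exists L, is_mean L /\
    forall w, 0 < Im w -> cauchy_mean L w = boolean_power_cauchy P t w.
Proof.
move=> t0; have [phi [mphi phix phiE]] := finitely_valued_approximation P.
pose Gn n w : R[i] := (\int[P]_x Re (w - (phi n x)%:C)^-1) +i*
                      (\int[P]_x Im (w - (phi n x)%:C)^-1).
have step n : exists L, is_mean L /\ forall w, Im w != 0 ->
    cauchy_mean L w * ((1 - t%:C) * w * Gn n w + t%:C) = Gn n w.
  have [m [p [a [p0 p1 pa]]]] := phiE n.
  have [c [lam [c0 c1 clam]]] := boolean_power_finite a p0 p1 t0.
  exists (fun f => \sum_k c k * f (lam k)); split.
    exact: (mean_convex c0 c1 (fun k => mean_eval (lam k))).
  move=> w w0.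
  have -> : Gn n w = \sum_j (p j)%:C * (w - (a j)%:C)^-1.
    rewrite -cauchy_convex; apply: complex_ext => /=.
      exact: (pa (fun x => Re (w - x%:C)^-1)).2.
    exact: (pa (fun x => Im (w - x%:C)^-1)).2.
  by rewrite cauchy_convex; exact: clam.
have [Ln LnE] := choice step.
have [U [L [UU ooU mL LnL]]] := mean_limit (fun n => (LnE n).1).
have PU : ProperFilter U := @ultra_proper _ _ UU.
exists L; split => // w w0; have wI : Im w != 0 by rewrite gt_eqF.
have lnl : ccvg U (fun n => cauchy_mean (Ln n) w) (cauchy_mean L w).
  by split; apply: LnL; [exact: bmeas_Re_kernel|exact: bmeas_Im_kernel].
have Gl : ccvg U (fun n => Gn n w) (Gtransform P w).
  apply: (ccvg_sub ooU); split.
    apply: (@bounded_cvg_integral _ P _ _ `|Im w|^-1) => [n|n x|x].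
    - exact: (measurableT_comp (bmeas_Re_kernel wI).1 (mphi n)).
    - exact: normr_Re_le (kernel_bounded _ wI).
    - exact: (cvg_comp _ _ (phix x) (kernel_ccvg x wI).1).
  apply: (@bounded_cvg_integral _ P _ _ `|Im w|^-1) => [n|n x|x].
  - exact: (measurableT_comp (bmeas_Im_kernel wI).1 (mphi n)).
  - exact: normr_Im_le (kernel_bounded _ wI).
  - exact: (cvg_comp _ _ (phix x) (kernel_ccvg x wI).2).
(* The identity of [boolean_power_finite] passes to the limit as it stands;
   dividing by the denominator is only possible afterwards. *)
have lim1 : ccvg U (fun n => Gn n w)
    (cauchy_mean L w * ((1 - t%:C) * w * Gtransform P w + t%:C)).
  rewrite (_ : (fun n => Gn n w) =
    fun n => cauchy_mean (Ln n) w * ((1 - t%:C) * w * Gn n w + t%:C)).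
    apply: ccvgM => //; apply: ccvgD; last exact: ccvg_cst.
    by apply: ccvgM => //; exact: ccvg_cst.
  by apply/funext => n; rewrite (LnE n).2.
have E := ccvg_unique lim1 Gl.
have [G0 _] := reciprocal_Gtransform P w0.
have D0 : (1 - t%:C) * w + t%:C * (Gtransform P w)^-1 != 0.
  by rewrite Im_neq0// gt_eqF// (lt_le_trans w0)// power_denominator_Im.
apply: (mulIf D0); rewrite /boolean_power_cauchy mulVf//.
apply: (mulIf G0); rewrite mul1r -[RHS]E -mulrA; congr (_ * _).
by rewrite mulrDl mulfVK.
Qed.

(** The mixture cannot be defined as [f |-> \int Lt t f], because [t |-> Lt t f]
    need not be measurable for all [f]. It is obtained as a limit of finite
    mixtures, and agrees with the integral for those [f] that matter. *)
Lemma mixture_mean P (Lt : R -> (R -> R) -> R) : (forall t, is_mean (Lt t)) ->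
  exists L, is_mean L /\ forall f, bounded_measurable f ->
    continuous (fun t => Lt t f) ->
    L f = \int[P]_t Lt t f.
Proof.
move=> mLt; have [phi [mphi phix phiE]] := finitely_valued_approximation P.
have step n : exists L, is_mean L /\ forall f, L f = \int[P]_t Lt (phi n t) f.
  have [m [p [a [p0 p1 pa]]]] := phiE n.
  exists (fun f => \sum_j p j * Lt (a j) f); split.
    exact: (mean_convex p0 p1 (fun j => mLt (a j))).
  by move=> f; rewrite (pa (fun t => Lt t f)).2.
have [Ln LnE] := choice step.
have [U [L [UU ooU mL LnL]]] := mean_limit (fun n => (LnE n).1).
have PU : ProperFilter U := @ultra_proper _ _ UU.
exists L; split => // f bf cf; have [M fM] := bf.2.
suff H : Ln n f @[n --> U] --> \int[P]_t Lt t f.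
  by apply: (cvg_unique _ (LnL f bf) H); exact: Rhausdorff.
under eq_cvg do rewrite (LnE _).2.
apply: (cvg_trans (cvg_app _ ooU)).
apply: (@bounded_cvg_integral _ P _ _ M) => [n|n x|x].
- exact: (measurableT_comp (continuous_measurable_fun cf) (mphi n)).
- rewrite -[leRHS](mean_cst (mLt (phi n x))).
  by apply: (le_norm_mean (mLt _)) => //; exact: bmeas_cst.
- exact: (cvg_comp _ _ (phix x) (cf x)).
Qed.

End Construction.

(** * Mixtures of Boolean powers and the eta-transform *)

Section Final.
Context {R : realType}.
Implicit Types (z w : R[i]) (L : (R -> R) -> R) (P : probability (measurableTypeR R) R).

Lemma Im_scale (x : R) z : Im (x%:C * z) = x * Im z.
Proof. by rewrite ImM/= mul0r addr0. Qed.

(** Truncating [t] at 0 makes the family bounded and continuous on the whole line,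
    and changes nothing for a measure carried by the nonnegative numbers. *)
Definition mixture_cauchy P w (t : R) := boolean_power_cauchy P (Num.max t 0) w.

Lemma max0_ge0 (t : R) : 0 <= Num.max t 0.
Proof. by rewrite le_max lexx orbT. Qed.

Lemma pos_denominator_neq0 P w (t : R) : 0 < Im w -> 0 <= t ->
  (1 - t%:C) * w + t%:C * (Gtransform P w)^-1 != 0.
Proof.
by move=> w0 t0; rewrite Im_neq0// gt_eqF// (lt_le_trans w0)// power_denominator_Im.
Qed.

Lemma mixture_cauchy_le P w t : 0 < Im w ->
  `|mixture_cauchy P w t| <= ((Im w)^-1)%:C.
Proof.
move=> w0; apply: norm_inv_le => //; apply: le_trans (ler_norm _).
exact: power_denominator_Im (max0_ge0 t).
Qed.

Lemma mixture_cauchy_ccvg P w t : 0 < Im w ->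
  ccvg (nbhs t) (mixture_cauchy P w) (mixture_cauchy P w t).
Proof.
move=> w0; apply: ccvgV; first exact: pos_denominator_neq0 (max0_ge0 t).
have mx : ccvg (nbhs t) (fun s : R => (Num.max s 0)%:C) (Num.max t 0)%:C.
  split; last exact: cvg_cst.
  rewrite /= maxr_absE; under eq_cvg do rewrite maxr_absE.
  apply: cvgM; last exact: cvg_cst.
  apply: cvgD; first by apply: cvgD; [exact: cvg_id|exact: cvg_cst].
  by apply: cvg_norm; apply: cvgB; [exact: cvg_id|exact: cvg_cst].
have mx1 : ccvg (nbhs t) (fun s : R => 1 - (Num.max s 0)%:C) (1 - (Num.max t 0)%:C).
  rewrite -[- (_%:C)]mulN1r (_ : (fun s => _) = fun s => 1 + (-1) * (Num.max s 0)%:C).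
    by apply: ccvgD; [exact: ccvg_cst|apply: ccvgM => //; exact: ccvg_cst].
  by apply/funext => s; rewrite mulN1r.
by apply: ccvgD; apply: ccvgM => //; exact: ccvg_cst.
Qed.

Lemma bmeas_mixture_cauchy P w : 0 < Im w ->
  bounded_measurable (fun t => Re (mixture_cauchy P w t)) /\
  bounded_measurable (fun t => Im (mixture_cauchy P w t)).
Proof.
move=> w0; split; apply: (bmeas_continuous (M := (Im w)^-1)).
- by move=> t; have [] := mixture_cauchy_ccvg P t w0.
- by move=> t; exact: normr_Re_le (mixture_cauchy_le _ _ w0).
- by move=> t; have [] := mixture_cauchy_ccvg P t w0.
- by move=> t; exact: normr_Im_le (mixture_cauchy_le _ _ w0).
Qed.

Lemma convolution_mean P1 P2 : exists L, is_mean L /\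
  forall w, 0 < Im w -> cauchy_mean L w = Cintegral P1 (mixture_cauchy P2 w).
Proof.
have [Lt LtE] := choice (fun t => boolean_power_mean P2 (max0_ge0 t)).
have [L [mL LE]] := mixture_mean P1 (fun t => (LtE t).1).
exists L; split => // w w0; have wI : Im w != 0 by rewrite gt_eqF.
have LtR t : Lt t (fun x => Re (w - x%:C)^-1) = Re (mixture_cauchy P2 w t).
  by rewrite /mixture_cauchy -(LtE t).2.
have LtI t : Lt t (fun x => Im (w - x%:C)^-1) = Im (mixture_cauchy P2 w t).
  by rewrite /mixture_cauchy -(LtE t).2.
have cR : continuous (fun t => Lt t (fun x => Re (w - x%:C)^-1)).
  rewrite (funext LtR) => t; exact: (mixture_cauchy_ccvg P2 t w0).1.
have cI : continuous (fun t => Lt t (fun x => Im (w - x%:C)^-1)).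
  rewrite (funext LtI) => t; exact: (mixture_cauchy_ccvg P2 t w0).2.
apply: complex_ext => /=.
  by rewrite (LE _ (bmeas_Re_kernel wI) cR); apply: eq_Rintegral => t _.
by rewrite (LE _ (bmeas_Im_kernel wI) cI); apply: eq_Rintegral => t _.
Qed.

(** [y / (i y - x) = 1 / (i - x / y)], which is bounded by 1 and tends to
    [1 / i]. *)
Lemma Gtransform_asymptotics P :
  ccvg \oo (fun n => n.+1%:R%:C * Gtransform P (n.+1%:R *i)) (- 'i).
Proof.
have cint1 : Cintegral P (fun=> - 'i) = - 'i.
  have mP : is_mean _ := mean_integral P.
  by apply: complex_ext; exact: (mean_cst mP).
pose k n (x : R) := ('i - (x / n.+1%:R)%:C)^-1 : R[i].
have nC n : n.+1%:R != 0 :> R by rewrite pnatr_eq0.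
(* Up to the factor [n + 1], [k n] is the kernel at [w = i (n + 1)]. *)
have kE n x : k n x = n.+1%:R%:C * (n.+1%:R *i - x%:C)^-1.
  rewrite /k; have -> : n.+1%:R *i - x%:C =
      n.+1%:R%:C * ('i - (x / n.+1%:R)%:C) :> R[i].
    by apply: complex_ext; rewrite /=; field.
  rewrite invfM mulrA mulfV ?mul1r//.
  by rewrite -(rmorph0 (real_complex R)) (inj_eq (@complexI R)).
have kb n x : `|k n x| <= 1%:C.
  by rewrite -invr1; apply: norm_inv_le => //; rewrite Im_sub_real/= normr1.
have i0 : 'i != 0 :> R[i] by rewrite Im_neq0//= oner_neq0.
have kl x : ccvg \oo (fun n => k n x) (- 'i).
  have -> : - 'i = 'i^-1 :> R[i] by apply: complex_ext => /=; field.
  apply: ccvgV => //; split => /=.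
    rewrite -[X in _ --> X]subr0; apply: cvgB; first exact: cvg_cst.
    rewrite -(mulr0 x); apply: cvgM; [exact: cvg_cst|exact: cvg_harmonic].
  by rewrite -[X in _ --> X]subr0; apply: cvgB; exact: cvg_cst.
have nI n : Im (n.+1%:R *i : R[i]) != 0 by rewrite /= pnatr_eq0.
have mP : is_mean _ := mean_integral P.
have RkE n x : Re (k n x) = n.+1%:R * Re (n.+1%:R *i - x%:C)^-1.
  by rewrite kE ReM/= mul0r subr0.
have IkE n x : Im (k n x) = n.+1%:R * Im (n.+1%:R *i - x%:C)^-1.
  by rewrite kE ImM/= mul0r addr0.
have bR n : bounded_measurable (fun x => Re (k n x)).
  by rewrite (funext (RkE n)); apply: bmeasZ; exact: bmeas_Re_kernel.
have bI n : bounded_measurable (fun x => Im (k n x)).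
  by rewrite (funext (IkE n)); apply: bmeasZ; exact: bmeas_Im_kernel.
have E : (fun n => n.+1%:R%:C * Gtransform P (n.+1%:R *i)) =
    fun n => Cintegral P (k n).
  apply/funext => n; apply: complex_ext.
    rewrite ReM/= mul0r subr0 -(meanZ mP _ (bmeas_Re_kernel (nI n))).
    by apply: eq_Rintegral => x _; exact: (esym (RkE n x)).
  rewrite ImM/= mul0r addr0 -(meanZ mP _ (bmeas_Im_kernel (nI n))).
  by apply: eq_Rintegral => x _; exact: (esym (IkE n x)).
rewrite E -cint1; split.
- apply: (@bounded_cvg_integral _ P _ _ 1) => [n|n x|x].
  + exact: (bR n).1.
  + exact: normr_Re_le (kb n x).
  + exact: (kl x).1.
- apply: (@bounded_cvg_integral _ P _ _ 1) => [n|n x|x].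
  + exact: (bI n).1.
  + exact: normr_Im_le (kb n x).
  + exact: (kl x).2.
Qed.

Lemma mixture_cauchy_asymptotics P t :
  ccvg \oo (fun n => n.+1%:R%:C * mixture_cauchy P (n.+1%:R *i) t) (- 'i).
Proof.
set s := Num.max t 0.
have nC n : n.+1%:R%:C != 0 :> R[i].
  by rewrite -(rmorph0 (real_complex R)) (inj_eq (@complexI R)) pnatr_eq0.
have i0 : 'i != 0 :> R[i] by rewrite Im_neq0//= oner_neq0.
have ii : (- 'i)^-1 = 'i :> R[i].
  by apply: complex_ext; rewrite ?Re_inv ?Im_inv/=; field.
have E : (fun n => n.+1%:R%:C * mixture_cauchy P (n.+1%:R *i) t) = fun n =>
    ((1 - s%:C) * 'i + s%:C * (n.+1%:R%:C * Gtransform P (n.+1%:R *i))^-1)^-1.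
  apply/funext => n; rewrite /mixture_cauchy /boolean_power_cauchy -/s.
  have -> : n.+1%:R *i = n.+1%:R%:C * 'i :> R[i].
    by apply: complex_ext; rewrite ?ReM ?ImM/=; ring.
  set y := n.+1%:R%:C; set g := Gtransform _ _.
  have -> : (1 - s%:C) * (y * 'i) + s%:C * g^-1 =
      y * ((1 - s%:C) * 'i + s%:C * (y * g)^-1).
    rewrite invfM mulrDr mulrCA; congr (_ + _).
    by rewrite [RHS]mulrCA mulVKf ?nC.
  by rewrite invfM mulrA mulfV ?mul1r ?nC.
have dE : (1 - s%:C) * 'i + s%:C * (- 'i)^-1 = 'i :> R[i].
  by rewrite ii -mulrDl subrK mul1r.
have -> : - 'i = ((1 - s%:C) * 'i + s%:C * (- 'i)^-1)^-1 :> R[i].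
  by rewrite dE; apply: (can_inj invrK); rewrite ii invrK.
rewrite E; apply: ccvgV; first by rewrite dE.
apply: ccvgD; first exact: ccvg_cst.
apply: ccvgM; first exact: ccvg_cst.
apply: ccvgV; first by rewrite oppr_eq0.
exact: Gtransform_asymptotics.
Qed.

(** By [tail_le] it suffices that [y Im G(i y)] tends to -1. The integrand does so
    for every [t], and is bounded by 1. *)
Lemma convolution_mean_tight P1 P2 L : is_mean L ->
  (forall w, 0 < Im w -> cauchy_mean L w = Cintegral P1 (mixture_cauchy P2 w)) ->
  forall e, 0 < e -> exists y, L (\1_[set x : R | y <= `|x|]) <= e.
Proof.
move=> mL LE e e0.
have mP : is_mean _ := mean_integral P1.
have nI n : 0 < Im (n.+1%:R *i : R[i]) by rewrite /= ltr0n.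
have lim : n.+1%:R * Im (cauchy_mean L (n.+1%:R *i)) @[n --> \oo] --> (-1 : R).
  under eq_cvg do rewrite (LE _ (nI _)) -(meanZ mP _ (bmeas_mixture_cauchy P2 (nI _)).2).
  rewrite -(mean_cst mP (-1)).
  have ImE n t : n.+1%:R * Im (mixture_cauchy P2 (n.+1%:R *i) t) =
      Im (n.+1%:R%:C * mixture_cauchy P2 (n.+1%:R *i) t).
    exact/esym/Im_scale.
  apply: (@bounded_cvg_integral _ P1 _ _ 1) => [n|n x|x].
  - exact: (bmeasZ _ (bmeas_mixture_cauchy P2 (nI _)).2).1.
  - rewrite normrM ger0_norm// mulrC -ler_pdivlMr ?ltr0n// mul1r.
    exact: normr_Im_le (mixture_cauchy_le _ _ (nI n)).
  - under eq_cvg do rewrite ImE.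
    exact: (mixture_cauchy_asymptotics P2 x).2.
have lim2 : 2 * (1 + n.+1%:R * Im (cauchy_mean L (n.+1%:R *i))) @[n --> \oo]
    --> (2 * (1 + (-1)) : R).
  apply: cvgM; first exact: cvg_cst.
  by apply: cvgD; [exact: cvg_cst|exact: lim].
move: lim2; rewrite subrr mulr0.
move/cvgrPdist_le => /(_ e e0) [n _ /(_ n (leqnn n)) H].
exists n.+1%:R; apply: (le_trans (tail_le mL _)); rewrite ?ltr0n//.
by apply: le_trans H; rewrite sub0r normrN ler_norm.
Qed.

(** [y^-1] is the pointwise limit of the continuous functions
    [y / (y^2 + 1 / (n + 1))], at [y = 0] as well since [0^-1 = 0]. *)
Lemma measurable_inv : measurable_fun [set: R] (fun y : R => y^-1).
Proof.
have mh n : measurable_fun [set: R] (fun y : R => y / (y ^+ 2 + n.+1%:R^-1)).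
  apply: continuous_measurable_fun => y.
  apply: cvgM; first exact: cvg_id.
  apply: cvgV; first by rewrite gt_eqF// ltr_wpDl ?sqr_ge0// invr_gt0.
  by apply: cvgD; [apply: cvgM; exact: cvg_id|exact: cvg_cst].
apply: (measurable_fun_cvg mh).
move=> y _; have [->|y0] := eqVneq y 0.
  by rewrite invr0; under eq_cvg do rewrite mul0r; exact: cvg_cst.
rewrite (_ : y^-1 = y / (y ^+ 2 + 0)); last by field.
apply: cvgM; first exact: cvg_cst.
apply: cvgV; first by rewrite addr0 expf_neq0.
by apply: cvgD; [exact: cvg_cst|exact: cvg_harmonic].
Qed.

(** Here [w] may be real, in which case the function has a pole. *)
Lemma measurable_kernel w :
  measurable_fun [set: R] (fun t : R => Re (w - t%:C)^-1) /\
  measurable_fun [set: R] (fun t : R => Im (w - t%:C)^-1).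
Proof.
have mt : measurable_fun [set: R] (fun t : R => Re w - t).
  by apply: measurable_funB => //; exact: measurable_cst.
have md : measurable_fun [set: R] (fun t : R => ((Re w - t) ^+ 2 + Im w ^+ 2)^-1).
  apply: (measurableT_comp measurable_inv); apply: measurable_funD => //.
  exact: measurable_funX.
split.
  rewrite (_ : (fun t => _) = fun t => (Re w - t) * ((Re w - t) ^+ 2 + Im w ^+ 2)^-1).
    exact: measurable_funM.
  by apply/funext => t; rewrite Re_inv Im_sub_real Re_sub_real.
rewrite (_ : (fun t => _) = fun t => (- Im w) * ((Re w - t) ^+ 2 + Im w ^+ 2)^-1).
  by apply: measurable_funM => //; exact: measurable_cst.
by apply/funext => t; rewrite Im_inv Im_sub_real Re_sub_real mulNr.
Qed.

Lemma eq_Rintegral_support P (f g : R -> R) : P `[0, +oo[%classic = 1%E ->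
  measurable_fun [set: R] f -> measurable_fun [set: R] g ->
  (forall t, 0 <= t -> f t = g t) -> \int[P]_t f t = \int[P]_t g t.
Proof.
move=> P1 mf mg fg; rewrite /Rintegral; congr fine.
apply: ae_eq_integral => //; [exact/measurable_EFinP|exact/measurable_EFinP|].
exists (~` `[0, +oo[%classic); split.
- by apply: measurableC; exact: measurable_itv.
- have := probability_setC P (measurable_itv `[0, +oo[).
  by rewrite P1 subee.
- move=> t /= Nt t0; apply: Nt => _.
  by move: t0; rewrite /= in_itv/= andbT => /fg ->.
Qed.

(** Let [e] be the value of [eta] for [P2]. The denominator of the Boolean power is
    [(1 - t e) / z], so that [1 / (1 / e - t) = (e / z) K_t] for [t >= 0]:
    integrating over [P1] gives [G_P1 (1 / e) = (e / z) G_P (1 / z)], which is the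
    claim. If [e = 0], then [K_t = z] for all [t] and both sides vanish. *)
Lemma eta_transform_identity P1 P2 P :
  P1 `[0, +oo[%classic = 1%E ->
  (forall w, 0 < Im w -> Gtransform P w = Cintegral P1 (mixture_cauchy P2 w)) ->
  forall z, Im z < 0 ->
    eta_transform P z = eta_transform P1 (eta_transform P2 z).
Proof.
move=> P1_ge0 PE z zI; have z0 : z != 0 by rewrite Im_neq0// lt_eqF.
have w0 : 0 < Im z^-1.
  rewrite Im_inv -mulNr divr_gt0 ?oppr_gt0//.
  by rewrite lt_neqAle eq_sym normsq_neq0// addr_ge0 ?sqr_ge0.
have mP : is_mean _ := mean_integral P1.
rewrite /eta_transform /Ftransform (negPf z0) PE//.
set g := (Gtransform P2 z^-1)^-1; set e := 1 - z * g.
set H := Cintegral P1 (mixture_cauchy P2 z^-1).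
have DE (t : R) : (1 - t%:C) * z^-1 + t%:C * g = z^-1 * (1 - t%:C * e).
  by rewrite /e; field.
have kE (t : R) : 0 <= t -> mixture_cauchy P2 z^-1 t = (z^-1 * (1 - t%:C * e))^-1.
  by move=> t0; rewrite /mixture_cauchy /boolean_power_cauchy max_l// -/g DE.
case: eqVneq => [e0|e0].
  have -> : H = z.
    rewrite /H (_ : mixture_cauchy P2 z^-1 = fun=> z).
      by apply: complex_ext; exact: (mean_cst mP).
    apply/funext => t; rewrite /mixture_cauchy /boolean_power_cauchy -/g DE e0.
    by rewrite mulr0 subr0 mulr1 invrK.
  by rewrite mulfV// subrr.
have [bR bI] := bmeas_mixture_cauchy P2 w0.
have [mR mI] := measurable_kernel e^-1.
have H1 : Gtransform P1 e^-1 = e * z^-1 * H.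
  have iE (t : R) : 0 <= t -> (e^-1 - t%:C)^-1 = e * z^-1 * mixture_cauchy P2 z^-1 t.
    move=> t0; rewrite kE//.
    have -> : e^-1 - t%:C = e^-1 * (1 - t%:C * e).
      by rewrite mulrBr mulr1 mulrCA mulVf// mulr1.
    by rewrite !invfM !invrK mulrA mulfVK.
  pose a := Re (e * z^-1); pose b := Im (e * z^-1).
  have RE (t : R) : 0 <= t -> Re (e^-1 - t%:C)^-1 =
      a * Re (mixture_cauchy P2 z^-1 t) - b * Im (mixture_cauchy P2 z^-1 t).
    by move=> t0; rewrite iE// ReM.
  have IE (t : R) : 0 <= t -> Im (e^-1 - t%:C)^-1 =
      a * Im (mixture_cauchy P2 z^-1 t) + b * Re (mixture_cauchy P2 z^-1 t).
    by move=> t0; rewrite iE// ImM.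
  have bRE := bmeasB (bmeasZ a bR) (bmeasZ b bI).
  have bIE := bmeasD (bmeasZ a bI) (bmeasZ b bR).
  apply: complex_ext => /=.
    rewrite (eq_Rintegral_support P1_ge0 mR bRE.1 RE).
    rewrite (meanB mP (bmeasZ a bR) (bmeasZ b bI)) (meanZ mP _ bR) (meanZ mP _ bI).
    by rewrite [RHS]ReM.
  rewrite (eq_Rintegral_support P1_ge0 mI bIE.1 IE).
  rewrite (meanD mP (bmeasZ a bI) (bmeasZ b bR)) (meanZ mP _ bR) (meanZ mP _ bI).
  by rewrite [RHS]ImM.
rewrite H1 !invfM invrK [e * (_ * _)]mulrA [e * (_ * _)]mulrA mulfV//.
by rewrite mul1r.
Qed.

End Final.

Theorem theorem3p4 (R : realType)
    (mu1 mu2 : probability (measurableTypeR R) R)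
    (mu1_ge0 : mu1 `[0, +oo[%classic = 1%E) :
  exists mu : probability (measurableTypeR R) R,
    forall z : R[i], complex.Im z < 0 ->
      eta_transform mu z = eta_transform mu1 (eta_transform mu2 z).
Proof.
have [L [mL LE]] := convolution_mean mu1 mu2.
have [mu muE] := cauchy_mean_representation mL (convolution_mean_tight mL LE).
exists mu; apply: eta_transform_identity mu1_ge0 _ => w w0.
by rewrite muE ?LE// gt_eqF.
Qed.
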